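(* The group generated by the round functions of AES with independent subkeys is primitive. That is, with $V$, $\gamma$, $\lambda$ the AES data described in the context and $\rho = \gamma\lambda$, the group $G = \langle\, \rho\sigma_k : k \in V\,\rangle \le \mathrm{Sym}(V)$ acts primitively on $V$.
   Context: Maps are written on the right and composed left to right. For $k\in V$, $\sigma_k : V \to V$ is the translation $w \mapsto w+k$. Description of AES used here. Let $\mathrm{GF}(2^8) = \mathrm{GF}(2)[X]/(X^8+X^4+X^3+X+1)$, let $\theta$ be the class of $X$, and identify a byte $(a_0,\dots,a_7)$ with $\sum_j a_j\theta^j$. The state space $V$ is the space of $4 \times 4$ arrays $(a_{i,j})_{0\le i,j\le 3}$ (row $i$, column $j$) with entries in $\mathrm{GF}(2^8)$, regarded as a $128$-dimensional vector space over $\mathrm{GF}(2)$. The map $\gamma$ applies to every entry of the array the map $x \mapsto x^{2^8-2}$ on $\mathrm{GF}(2^8)$ (inversion on nonzero elements, with $0\mapsto 0$). The AES S-box is inversion followed by an affine map; the linear part of this affine map is moved into the mixing layer and its translation part is absorbed in the key addition. Thus the linear mixing layer is $\lambda = L\cdot\mathrm{ShiftRows}\cdot\mathrm{MixColumns}$ (applied in this order), where: - $L$ applies to each byte $(a_0,\dots,a_7)$ the invertible $\mathrm{GF}(2)$-linear map with output $(b_0,\dots,b_7)$, $b_j = a_j + a_{j+4}+a_{j+5}+a_{j+6}+a_{j+7}$, indices modulo $8$; - $\mathrm{ShiftRows}$ maps $(a_{i,j})$ to $(b_{i,j})$ with $b_{i,j} = a_{i,\,j+i}$, column index modulo $4$;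 - $\mathrm{MixColumns}$ multiplies each column (as a column vector) on the left by the circulant matrix over $\mathrm{GF}(2^8)$ with rows $(\theta,\theta+1,1,1)$, $(1,\theta,\theta+1,1)$, $(1,1,\theta,\theta+1)$, $(\theta+1,1,1,\theta)$. The round functions with independent subkeys are the permutations $\rho\sigma_k$, $k$ ranging over all of $V$. (The group $G$ contains all translations, hence is transitive on $V$.) A partition $\mathcal{B}$ of $V$ is $G$-invariant if $Bg \in \mathcal{B}$ for all $B \in \mathcal{B}$, $g \in G$; it is trivial if $\mathcal{B} = \{V\}$ or $\mathcal{B} = \{\{\alpha\} : \alpha \in V\}$. $G$ is primitive if the only $G$-invariant partitions of $V$ are the trivial ones. *)

(* Defs.v *)
From HB Require Import structures.
From mathcomp Require Import all_boot all_order all_algebra.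
From mathcomp Require Import all_fingroup all_solvable all_field.
From mathcomp Require Import ring.

Set Implicit Arguments.
Unset Strict Implicit.
Unset Printing Implicit Defensive.

Import GRing.Theory.
Local Open Scope ring_scope.

Definition aes_poly : {poly 'F_2} := 'X^8 + 'X^4 + 'X^3 + 'X + 1.

(* Irreducibility of aes_poly: polynomials over 'F_2 are encoded by bit lists
   (lowest degree first), and the products of a polynomial of degree at most 4
   by one of degree at most 7 are enumerated by computation. *)

Fixpoint bits_poly (s : seq bool) : {poly 'F_2} :=
  if s is b :: s' then (b : nat)%:R%:P + 'X * bits_poly s' else 0.

Fixpoint bits_add (s t : seq bool) : seq bool :=
  match s, t with
  | a :: s', b :: t' => (a (+) b) :: bits_add s' t'
  | [::], _ => t
  | _, [::] => s
  end.

Fixpoint bits_mul (s t : seq bool) : seq bool :=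
  if s is a :: s' then bits_add (if a then t else [::]) (false :: bits_mul s' t)
  else [::].

Fixpoint all_bits (n : nat) : seq (seq bool) :=
  if n is n'.+1 then
    [seq false :: s | s <- all_bits n'] ++ [seq true :: s | s <- all_bits n']
  else [:: [::]].

Lemma mem_all_bits (s : seq bool) : s \in all_bits (size s).
Proof.
elim: s => [|[] s IHs] //=; rewrite mem_cat; apply/orP.
  by right; apply: map_f.
by left; apply: map_f.
Qed.

Lemma coef_bits_poly (s : seq bool) i :
  (bits_poly s)`_i = (nth false s i : nat)%:R.
Proof.
elim: s i => [|b s IHs] i /=; first by rewrite coef0 nth_nil.
by rewrite coefD coefC coefXM; case: i => [|i] /=; rewrite ?addr0 ?add0r.
Qed.

Lemma bits_poly_add (s t : seq bool) :
  bits_poly (bits_add s t) = bits_poly s + bits_poly t.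
Proof.
elim: s t => [|a s IHs] [|b t] /=; rewrite ?add0r ?addr0 //.
rewrite IHs mulrDr addrACA -polyCD; congr (_%:P + _).
by apply/val_inj; case: a b => [] [].
Qed.

Lemma bits_poly_mul (s t : seq bool) :
  bits_poly (bits_mul s t) = bits_poly s * bits_poly t.
Proof.
elim: s => [|a s IHs] /=; first by rewrite mul0r.
rewrite bits_poly_add /= IHs polyC0 add0r mulrDl mulrA.
by case: a; rewrite /= ?polyC1 ?polyC0 ?mul1r ?mul0r.
Qed.

Lemma bits_polyP (n : nat) (p : {poly 'F_2}) : (size p <= n)%N ->
  exists2 s, s \in all_bits n & p = bits_poly s.
Proof.
move=> le_p_n; exists (mkseq (fun i => p`_i != 0) n).
  by rewrite -[n in all_bits n](size_mkseq (fun i => p`_i != 0)) mem_all_bits.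
apply/polyP=> i; rewrite coef_bits_poly; have [lt_i_n | le_n_i] := ltnP i n.
  by rewrite nth_mkseq //; case: p`_i => [] [|[|m]] // ?; apply/val_inj.
by rewrite !nth_default ?size_mkseq ?(leq_trans le_p_n).
Qed.

Definition aes_bits : seq bool :=
  [:: true; true; false; true; true; false; false; false; true].

Lemma aes_bitsE : bits_poly aes_bits = aes_poly.
Proof. by rewrite /= /aes_poly !(polyC0, polyC1); ring. Qed.

Lemma size_aes_poly : size aes_poly = 9.
Proof.
have le9 : (size aes_poly <= 9)%N.
  rewrite -aes_bitsE; apply/leq_sizeP => i le_9_i.
  by rewrite coef_bits_poly nth_default.
apply/eqP; rewrite eqn_leq le9 ltnNge; apply/negP=> /leq_sizeP/(_ 8 (leqnn _)).
by rewrite -aes_bitsE coef_bits_poly.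
Qed.

Lemma aes_poly_monic : aes_poly \is monic.
Proof. by rewrite monicE lead_coefE size_aes_poly -aes_bitsE coef_bits_poly. Qed.

Lemma aes_bits_check :
  all (fun s => all (fun t =>
    all (fun i => nth false (bits_mul s t) i == nth false aes_bits i) (iota 0 12)
      ==> ~~ has id (behead s)) (all_bits 8)) (all_bits 5).
Proof. by vm_compute. Qed.

Lemma aes_poly_factor (p q : {poly 'F_2}) :
  p * q = aes_poly -> (size p <= 5)%N -> (size q <= 8)%N -> (size p <= 1)%N.
Proof.
move=> def_pq /bits_polyP[s s_bits def_p] /bits_polyP[t t_bits def_q].
have /allP/(_ s s_bits)/allP/(_ t t_bits)/implyP chk := aes_bits_check.
have {chk} s_cst : ~~ has id (behead s).
  apply: chk; apply/allP=> i _; have /(congr1 (fun r : {poly 'F_2} => r`_i)) := def_pq.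
  rewrite def_p def_q -bits_poly_mul -aes_bitsE !coef_bits_poly.
  by do 2!case: (nth _ _ i).
rewrite def_p; apply/leq_sizeP=> [[|i]] // _.
rewrite coef_bits_poly; case: (boolP (nth false s i.+1)) => // s_i.
case/hasP: s_cst; exists (nth false s i.+1) => //.
rewrite -nth_behead mem_nth // ltnNge; apply/negP=> le_s_i.
by move: s_i; rewrite -nth_behead nth_default.
Qed.

Lemma aes_poly_irreducible : monic_irreducible_poly aes_poly.
Proof.
split; last exact: aes_poly_monic.
have aes_neq0 : aes_poly != 0 by rewrite -size_poly_gt0 size_aes_poly.
split=> [|p size_p /dvdpP[q def_aes]]; first by rewrite size_aes_poly.
have p_neq0 : p != 0 by apply: contraNneq aes_neq0 => p0; rewrite def_aes p0 mulr0.
have q_neq0 : q != 0 by apply: contraNneq aes_neq0 => q0; rewrite def_aes q0 mul0r.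
have p_gt1 : (1 < size p)%N by move: size_p p_neq0; rewrite -size_poly_gt0; case: size => [|[]].
have q_gt0 : (0 < size q)%N by rewrite size_poly_gt0.
have size_pq : (size q + size p = 10)%N.
  have /eqP := size_aes_poly; rewrite def_aes size_mul //.
  by case: (size q + size p)%N => //= n /eqP->.
have [q_gt1 | q_le1] := ltnP 1 (size q); last first.
  rewrite -dvdp_size_eqp ?size_aes_poly; last by rewrite def_aes dvdp_mulIr.
  by rewrite -(eqn_add2l (size q)) size_pq (anti_leq (introT andP (conj q_le1 q_gt0))).
have [p_le5 | p_gt5] := leqP (size p) 5.
  have p_le1 : (size p <= 1)%N.
    apply: (@aes_poly_factor p q); rewrite ?def_aes 1?mulrC //.
    by rewrite -(leq_add2r 2) -[(8 + 2)%N]size_pq leq_add2l.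
  by rewrite leqNgt p_gt1 in p_le1.
have q_le1 : (size q <= 1)%N.
  apply: (@aes_poly_factor q p); rewrite ?def_aes //.
    by rewrite -(leq_add2r 5) -[(5 + 5)%N]size_pq leq_add2l ltnW.
  by rewrite -(leq_add2l 2) -[(2 + 8)%N]size_pq leq_add2r.
by rewrite leqNgt q_gt1 in q_le1.
Qed.

Definition GF256 : finFieldType := {poly %/ aes_poly with aes_poly_irreducible}.

Definition theta : GF256 := 'qX.

(* The polynomial underlying x : GF256 is its representative of degree at
   most 7, so byte_bit x j is the coefficient of theta ^+ j, with j mod 8. *)
Definition byte_bit (x : GF256) (j : nat) : 'F_2 :=
  (x : {poly %/ aes_poly})`_(j %% 8).

Definition byte_of_bits (b : nat -> 'F_2) : GF256 :=
  \sum_(j < 8) (b j *: (theta ^+ j : {poly %/ aes_poly})).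

Definition state := 'M[GF256]_4.

Definition gamma_fun (a : state) : state :=
  map_mx (fun x : GF256 => x ^+ (2 ^ 8 - 2)%N) a.

Definition sbox_linear (x : GF256) : GF256 :=
  byte_of_bits (fun j => byte_bit x j + byte_bit x (j + 4)
    + byte_bit x (j + 5) + byte_bit x (j + 6) + byte_bit x (j + 7)).

Definition sbox_linear_layer (a : state) : state := map_mx sbox_linear a.

(* The sum j + i is taken in 'I_4, that is, modulo 4. *)
Definition shift_rows (a : state) : state := \matrix_(i, j) a i (j + i).

Definition mix_matrix : 'M[GF256]_4 :=
  \matrix_(i, j)
    nth 0 (nth [::] [:: [:: theta; theta + 1; 1; 1];
                        [:: 1; theta; theta + 1; 1];
                        [:: 1; 1; theta; theta + 1];
                        [:: theta + 1; 1; 1; theta] ] i) j.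

Definition mix_columns (a : state) : state := mix_matrix *m a.

Definition lambda_fun (a : state) : state :=
  mix_columns (shift_rows (sbox_linear_layer a)).

Lemma card_GF256 : #|GF256| = 256%N.
Proof. by rewrite card_qfpoly size_aes_poly card_Fp. Qed.

Lemma gamma_fun_inj : injective gamma_fun.
Proof.
have powK : cancel (fun x : GF256 => x ^+ (2 ^ 8 - 2)%N)
                   (fun x => x ^+ (2 ^ 8 - 2)%N).
  move=> x; have x256 : x ^+ 256 = x by rewrite -{1}card_GF256 expf_card.
  have x511 : x ^+ 511 = x ^+ 256.
    by rewrite -[511%N]/(256 + 255)%N exprD x256 -exprS.
  have step n : x ^+ (n * 255).+1 = x.
    elim: n => [|n IHn]; first by rewrite expr1.
    by rewrite mulSn -addnS exprD IHn -exprSr.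
  rewrite -exprM; have -> : ((2 ^ 8 - 2) * (2 ^ 8 - 2) = (253 * 255).+1)%N.
    by apply/eqP; vm_compute.
  exact: step.
move=> a b /matrixP eq_ab; apply/matrixP=> i j.
by have := eq_ab i j; rewrite !mxE => /(can_inj powK).
Qed.

Lemma pchar_GF256 : 2 \in [pchar {poly %/ aes_poly}].
Proof. by rewrite pchar_qpoly pchar_Fp. Qed.

Lemma mk_monic_aes_poly : mk_monic aes_poly = aes_poly.
Proof. exact: mk_monicE aes_poly_irreducible. Qed.

Lemma byte_bitK (b : nat -> 'F_2) j : byte_bit (byte_of_bits b) j = b (j %% 8)%N.
Proof.
rewrite /byte_bit /byte_of_bits poly_of_qpoly_sum coef_sum.
have lt_j8 : (j %% 8 < 8)%N by rewrite ltn_mod.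
have coef_theta (i : 'I_8) :
    (b i *: (theta ^+ i : {poly %/ aes_poly}) : {poly %/ aes_poly})`_(j %% 8)
      = b i * ((j %% 8)%N == i :> nat)%:R.
  rewrite poly_of_qpolyZ coefZ -rmorphXn /= mk_monic_aes_poly Pdiv.CommonRing.rmodp_small ?coefXn //.
  by rewrite size_polyXn size_aes_poly ltnS.
rewrite (eq_bigr _ (fun i _ => coef_theta i)) (bigD1 (Ordinal lt_j8)) //=.
rewrite eqxx mulr1 big1 ?addr0 // => i ne_i.
by rewrite -[(_ == _ :> nat)]/(Ordinal lt_j8 == i) eq_sym (negPf ne_i) mulr0.
Qed.

Lemma byte_bit_inj (x y : GF256) : byte_bit x =1 byte_bit y -> x = y.
Proof.
move=> eq_xy; suff: (x : {poly %/ aes_poly}) = (y : {poly %/ aes_poly}) by [].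
apply/npolyP=> i; have [lt_i8 | le_8i] := ltnP i 8.
  by have := eq_xy i; rewrite /byte_bit modn_small.
by rewrite !big_coef_npoly // mk_monic_aes_poly size_aes_poly.
Qed.

Lemma sbox_linear_inj : injective sbox_linear.
Proof.
have two0 : 2 = 0 :> 'F_2 by apply/val_inj.
pose inv (c : nat -> 'F_2) j := c (j + 2)%N + c (j + 5)%N + c (j + 7)%N.
have invK (x : GF256) j : (j < 8)%N ->
    inv (byte_bit (sbox_linear x)) j = byte_bit x j.
  move=> lt_j8; rewrite /inv /sbox_linear !byte_bitK.
  by case: j lt_j8 => [|[|[|[|[|[|[|[|//]]]]]]]] _; rewrite /byte_bit /=; ring: two0.
move=> x y eq_xy; apply: byte_bit_inj => j.
have bit_mod z : byte_bit z j = byte_bit z (j %% 8) by rewrite /byte_bit modn_mod.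
by rewrite !bit_mod -!invK ?ltn_mod // eq_xy.
Qed.

Lemma circulant4_exp4 (R : comNzRingType) (t : R) : 2 = 0 :> R ->
  let M := \matrix_(i < 4, j < 4) nth 0 [:: t; t + 1; 1; 1] (j - i)%R in
  M *m (M *m (M *m M)) = 1%:M.
Proof.
move=> c2 M.
have c3 : 3 = 1 :> R by rewrite (natrD _ 2 1) c2 add0r.
have c4 : 4 = 0 :> R by rewrite (natrD _ 2 2) c2 add0r.
have sq : M *m M = \matrix_(i < 4, j < 4)
    nth 0 [:: t ^+ 2 + 1; 0; t ^+ 2; 0] (j - i)%R.
  apply/matrixP=> i j; rewrite !mxE !big_ord_recl big_ord0 !mxE.
  by case: i j => [[|[|[|[|//]]]] ?] [[|[|[|[|//]]]] ?] /=; ring: c2 c3 c4.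
rewrite mulmxA sq.
apply/matrixP=> i j; rewrite !mxE !big_ord_recl big_ord0 !mxE.
by case: i j => [[|[|[|[|//]]]] ?] [[|[|[|[|//]]]] ?] /=; ring: c2 c3 c4.
Qed.

Lemma mix_matrix4 :
  mix_matrix *m (mix_matrix *m (mix_matrix *m mix_matrix)) = 1%:M.
Proof.
have -> : mix_matrix =
    \matrix_(i < 4, j < 4) nth 0 [:: theta; theta + 1; 1; 1] (j - i)%R.
  apply/matrixP=> i j; rewrite !mxE.
  by case: i j => [[|[|[|[|//]]]] ?] [[|[|[|[|//]]]] ?].
by apply: circulant4_exp4; have /andP[_ /eqP] := pchar_GF256.
Qed.

Lemma mulmx_exp4_inj (R : pzRingType) n (M : 'M[R]_n) :
  M *m (M *m (M *m M)) = 1%:M -> injective (fun A : 'M[R]_n => M *m A).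
Proof.
move=> M4 A B eq_AB; rewrite -[A]mul1mx -[B]mul1mx -M4 -!mulmxA.
by rewrite eq_AB.
Qed.

Lemma lambda_fun_inj : injective lambda_fun.
Proof.
move=> a b /(mulmx_exp4_inj mix_matrix4)/matrixP eq_ab.
apply/matrixP=> i j; apply: sbox_linear_inj.
by have := eq_ab i (j - i); rewrite !mxE subrK.
Qed.

(* In {perm state}, maps act on the right and products compose from left to
   right: (s * t)%g x = t (s x). *)
Definition gamma : {perm state} := perm gamma_fun_inj.

Definition lambda : {perm state} := perm lambda_fun_inj.

Definition rho : {perm state} := (gamma * lambda)%g.

Definition sigma (k : state) : {perm state} := perm (addIr k).

(* Main.v *)
Require Import Defs.
From mathcomp Require Import all_boot all_order all_algebra.
From mathcomp Require Import all_fingroup all_solvable all_field.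
From mathcomp Require Import ring.

(** The group G contains every translation, because sigma k is the quotient of
    two generators, so the blocks of a G-invariant partition are the cosets of
    an additive subgroup U ([mem_pblock_sub], [pblock0_zmod_closed]), the block
    of 0.  It has to be shown that U is the whole state space as soon as it is
    nonzero.

    Since rho = gamma lambda permutes the cosets of U and fixes 0, the subgroup
    W = U lambda^-1 is the image of U under gamma, and gamma (u + v) - gamma v
    lies in W for u in U and all v.  Let u in U have a nonzero byte at position
    (i, j), and let v range over the states supported at (i, j), the brick of
    this position.  The elements gamma (u + v) - gamma v - gamma u of W lie in
    the brick, and they are numerous because inversion is far from being affine
    ([card_inv_difference]).  So U and W meet the brick in two large additive
    subgroups exchanged by inversion.  By Hua's identity ([hua_closed]) such a
    subgroup is stable under multiplication by a large subfield of GF(2^8),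
    hence it is the whole brick ([inv_closed_full], [brick_subset]).

    Thus U is the sum of the bricks of some set of positions.  Such a subgroup
    is invariant under gamma, hence under lambda.  ShiftRows followed by
    MixColumns sends a byte in row i of column j to the whole column j - i, as
    the entries of the MixColumns matrix are nonzero; starting from one position
    in U, one step fills a column, and a second step fills the state
    ([rho_block_full]). *)

Set Implicit Arguments.
Unset Strict Implicit.
Unset Printing Implicit Defensive.

Import GRing.Theory.
Local Open Scope ring_scope.

(** * Additive subgroups of a field and inversion *)

(** Hua's identity a - (a^-1 + (w^-1 - a)^-1)^-1 = a w a expresses the product
    a w a by additions, subtractions and inversions: w^-1 - a lies in [U], its
    inverse and a^-1 lie in [W], and the inverse of their sum lies in [U]. *)
Lemma hua_closed (F : fieldType) (U W : {pred F}) :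
    zmod_closed U -> zmod_closed W ->
    (forall x : F, (x^-1 \in W) = (x \in U)) ->
  forall a w, a \in U -> w \in W -> a ^+ 2 * w \in U.
Proof.
move=> clU clW UW a w Ua Ww; have [U0 UB] := clU.
have [-> | a0] := eqVneq a 0; first by rewrite expr0n mul0r.
have [-> | w0] := eqVneq w 0; first by rewrite mulr0.
have Uw : w^-1 \in U by rewrite -UW invrK.
have [wa | ne_wa] := eqVneq w^-1 a.
  by rewrite -wa expr2 -mulrA mulVf // mulr1.
set c := w^-1 - a.
have c0 : c != 0 by rewrite subr_eq0.
have Ws : a^-1 + c^-1 \in W.
  by apply: (GRing.zmod_closedD clW).2; rewrite UW //; apply: UB.
have cwa : 1 - w * a != 0.
  apply: contraNneq c0 => e.
  by rewrite /c -[a](mulKf w0) -[X in X - _]mulr1 -mulrBr e mulr0.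
have -> : a ^+ 2 * w = a - (a^-1 + c^-1)^-1.
  have -> : a^-1 + c^-1 = (a * c * w)^-1.
    by rewrite /c; field; rewrite w0 a0 mulNr mulrC cwa.
  by rewrite invrK /c; field.
by apply: UB => //; rewrite -UW invrK.
Qed.

Lemma pchar2_sqr_inj (F : fieldType) :
  2 \in [pchar F] -> injective (fun x : F => x ^+ 2).
Proof. by move=> F2; apply: (fmorph_inj (pFrobenius_aut F2)). Qed.

(** Applying Hua's identity to [U] and [W], then with their roles exchanged,
    shows that (a / b)^2 multiplies [U] into itself for all a, b in [U] with b
    nonzero.  Hence the ring [K] of multipliers of [U], which is a subfield, has
    at least #|U| elements.  A proper subfield has at most sqrt #|F| elements,
    so [K] is the whole field, and a nonzero [K]-stable subgroup of [F] is
    [F]. *)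
Lemma inv_closed_full (F : finFieldType) (U W : {set F}) :
    2 \in [pchar F] -> zmod_closed U -> zmod_closed W ->
    (forall x : F, (x^-1 \in W) = (x \in U)) -> (#|F| < #|U| ^ 2)%N ->
  U = [set: F].
Proof.
move=> F2 clU clW UW bigU; have [_ UB] := clU.
have WU x : (x^-1 \in U) = (x \in W) by rewrite -UW invrK.
pose K := [set c | [forall u in U, c * u \in U]].
have KU c u : c \in K -> u \in U -> c * u \in U.
  by rewrite inE => /forall_inP; apply.
have memK c : (forall u, u \in U -> c * u \in U) -> c \in K.
  by move=> H; rewrite inE; apply/forall_inP.
have KB : {in K &, forall c d, c - d \in K}.
  move=> c d Kc Kd; apply: memK => u Uu.
  by rewrite mulrBl; apply: UB; apply: (KU).
have KM : {in K &, forall c d, c * d \in K}.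
  move=> c d Kc Kd; apply: memK => u Uu.
  by rewrite -mulrA; apply: KU Kc (KU _ _ Kd Uu).
have KV c : c \in K -> c^-1 \in K.
  move=> Kc; have [-> | c0] := eqVneq c 0; first by rewrite invr0 -(subrr c) KB.
  (* In a finite field the inverse is a power. *)
  have KX n : c ^+ n \in K.
    elim: n => [|n IHn]; last by rewrite exprS KM.
    by apply: memK => u; rewrite mul1r.
  have [q defF] : exists q, #|F| = q.+2.
    by case: #|F| (finNzRing_gt1 F) => [|[|q]] // _; exists q.
  suff -> : c^-1 = c ^+ q by [].
  do 2!apply: (mulfI c0); rewrite mulfV // mulr1 -!exprS -defF.
  by rewrite expf_card.
have [b Ub b0] : exists2 b, b \in U & b != 0.
  apply/exists_inP; apply: contraLR bigU => /exists_inPn U1.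
  have /subset_leq_card : U \subset [set 0].
    by apply/subsetP=> u /U1; rewrite inE negbK.
  rewrite cards1 -leqNgt -(leq_exp2r _ _ (isT : 0 < 2)%N) exp1n.
  move=> /leq_trans-> //.
  exact: ltnW (finNzRing_gt1 F).
have leUK : (#|U| <= #|K|)%N.
  rewrite -(card_in_imset (f := fun a => a ^+ 2 * (b^-1) ^+ 2) (D := U)).
    apply: subset_leq_card; apply/subsetP=> _ /imsetP[a Ua ->].
    apply: memK => u Uu; rewrite -mulrA; apply: (hua_closed clU clW UW) => //.
    by apply: (hua_closed clW clU WU); rewrite ?UW.
  move=> x y _ _ /mulIf /=; rewrite expf_neq0 ?invr_neq0 // => /(_ isT).
  exact: pchar2_sqr_inj.
have KT : K = [set: F].
  apply/eqP; rewrite eqEsubset subsetT /=; apply/subsetPn=> -[x _ nKx].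
  (* As K is a field, 1 and an element x outside K are linearly independent
     over K, so K + K x has #|K| ^ 2 elements. *)
  have inj : {in setX K K &, injective (fun cd : F * F => cd.1 + x * cd.2)}.
    move=> [c d] [c' d'] /setXP[/= Kc Kd] /setXP[/= Kc' Kd'] /= e.
    have e' : x * (d - d') = c' - c.
      by rewrite -[c'](addrK (x * d')) -e; ring.
    have [dd | dd] := eqVneq d d'.
      move: e'; rewrite dd subrr mulr0 => /esym/eqP.
      by rewrite subr_eq0 => /eqP->.
    case/negP: nKx; have -> : x = (c' - c) * (d - d')^-1.
      by rewrite -e' mulfK // subr_eq0.
    by apply: KM; rewrite ?KV ?KB.
  have := leq_card_in _ _ inj; rewrite cardsX => le.
  move: bigU; rewrite ltnNge => /negP[].
  by apply: leq_trans le; rewrite -mulnn leq_mul.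
apply/setP=> x; rewrite inE.
by rewrite -[x](mulfVK b0) KU // KT inE.
Qed.

(** The derivative of inversion in the direction [a] is -a / (x (x + a)) except
    at the two points where x (x + a) = 0.  As x (x + a) is quadratic in x, each
    value is taken at most twice elsewhere, so every fibre has at most four
    elements. *)
Lemma card_inv_difference (F : finFieldType) (a : F) : a != 0 ->
  (#|F| <= #|[set ((x + a)^-1 - x^-1)%R | x : F]| * 4)%N.
Proof.
move=> a0; pose f x := (x + a)^-1 - x^-1.
rewrite -[X in (X <= _)%N]sum1_card (partition_big_imset f) -sum_nat_const /=.
apply: leq_sum => c _; rewrite sum1dep_card; set B := finset _.
have memB x : (x \in B) = (f x == c) by rewrite inE.
have [/existsP[x /and3P[Bx x0 xa]] | none] :=
    boolP [exists x, [&& x \in B, x != 0 & x + a != 0]].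
  apply: leq_trans (card_size [:: 0; - a; x; - a - x]).
  apply: subset_leq_card.
  apply/subsetP=> y By; rewrite !inE.
  have [//| y0] := eqVneq y 0; have [//| ya] := eqVneq y (- a).
  rewrite -subr_eq0 opprK in ya.
  have e : f x = f y by move: Bx By; rewrite !memB => /eqP-> /eqP->.
  have prod0 : (y - x) * (y + a + x) = 0.
    have fE z : z != 0 -> z + a != 0 -> f z = - a / (z * (z + a)).
      by move=> z0 za; rewrite /f; field; rewrite z0 za.
    move: e; rewrite !fE // => /(mulfI _); rewrite oppr_eq0.
    move=> /(_ a0) /invr_inj e.
    have -> : (y - x) * (y + a + x) = y * (y + a) - x * (x + a) by ring.
    by rewrite e subrr.
  move/eqP: prod0; rewrite mulf_eq0 subr_eq0 => /orP[-> // | e0].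
  have -> : (y == - a - x) = (y + a + x == 0).
    by rewrite -subr_eq0 opprB opprK addrAC addrA.
  by rewrite e0 !orbT.
apply: leq_trans (subset_leq_card (_ : _ \subset [:: 0; - a])) _.
  apply/subsetP=> y By; rewrite !inE; apply: contraR none.
  rewrite negb_or => /andP[y0 ya]; apply/existsP; exists y.
  by rewrite By y0 -[a]opprK subr_eq0.
exact: leq_trans (card_size _) _.
Qed.

(** * Block systems of a group containing all translations *)

Lemma mem_pblock_perm (T : finType) (G : {set {perm T}}) (Q : {set {set T}}) :
    partition Q [set: T] -> [acts G, on Q | 'P^*] ->
  forall g x y, g \in G -> (g x \in pblock Q (g y)) = (x \in pblock Q y).
Proof.
move=> partQ actQ g x y Gg.
have covQ z : z \in cover Q by rewrite (cover_partition partQ) inE.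
have -> : pblock Q (g y) = [set g z | z in pblock Q y].
  apply: def_pblock (partition_trivIset partQ) _ _.
    by have := acts_act actQ Gg (pblock Q y); rewrite pblock_mem.
  by rewrite mem_imset ?mem_pblock //; apply: perm_inj.
by rewrite mem_imset //; apply: perm_inj.
Qed.

(** Translations map blocks to blocks, so a block system is the set of cosets of
    the block of 0, which is therefore a subgroup. *)
Section Translations.

Variables (V : finZmodType) (G : {set {perm V}}) (Q : {set {set V}}).
Hypotheses (trG : forall k : V, perm (addIr k) \in G).
Hypotheses (partQ : partition Q [set: V]) (actQ : [acts G, on Q | 'P^*]).

Let covQ z : z \in cover Q.
Proof. by rewrite (cover_partition partQ) inE. Qed.

Lemma mem_pblock_sub x y : (x \in pblock Q y) = (x - y \in pblock Q 0).
Proof.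
by rewrite -(mem_pblock_perm partQ actQ x y (trG (- y))) !permE subrr.
Qed.

Lemma pblock0_zmod_closed : zmod_closed (pblock Q 0).
Proof.
split=> [|x y Ux Uy]; first by rewrite mem_pblock.
by rewrite -mem_pblock_sub (same_pblock (partition_trivIset partQ) Uy).
Qed.

Lemma mem_pblock0_perm_sub g x y :
  g \in G -> (g x - g y \in pblock Q 0) = (x - y \in pblock Q 0).
Proof. by move=> Gg; rewrite -!mem_pblock_sub (mem_pblock_perm partQ actQ). Qed.

Lemma card_pblock_partition : #|V| = (#|Q| * #|pblock Q 0%R|)%N.
Proof.
rewrite -cardsT; apply: card_uniform_partition partQ => B QB.
have /set0Pn[b Bb] : B != set0.
  by apply: contraTneq QB => ->; case/and3P: partQ.
have -> : B = [set u + b | u in pblock Q 0].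
  apply/setP=> x; rewrite -{1}(def_pblock (partition_trivIset partQ) QB Bb).
  by rewrite mem_pblock_sub -[x in RHS](subrK b) (mem_imset _ _ (addIr b)).
by rewrite (card_imset _ (addIr b)).
Qed.

End Translations.

(** * Bricks contained in an invariant subgroup *)

Lemma bricks_mem (F : finFieldType) m n (U : {set 'M[F]_(m, n)})
    (x : 'M[F]_(m, n)) :
    zmod_closed U ->
    (forall i j, x i j != 0 -> x i j *: delta_mx i j \in U) ->
  x \in U.
Proof.
move=> clU Ux; have [U0 _] := clU; rewrite [x]matrix_sum_delta.
have UD := (GRing.zmod_closedD clU).2.
apply: (big_ind (fun y => y \in U)) => // i _.
apply: (big_ind (fun y => y \in U)) => // j _.
by have [-> | /Ux //] := eqVneq (x i j) 0; rewrite scale0r.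
Qed.

(** Write gamma for entrywise inversion.  When x runs through the brick (i, j),
    gamma (u + x) - gamma x - gamma u vanishes outside the entry (i, j), and
    there it runs through a translate of the set of values of the derivative of
    inversion in the direction u i j.  So [W] meets the brick in at least
    #|F| / 4 elements; [U] meets it in the inverses of these, and both
    intersections are additive subgroups.  When #|F| > 16, #|F| / 4 exceeds the
    square root of #|F|, and the intersection is the whole brick by
    [inv_closed_full]. *)
Lemma brick_subset (F : finFieldType) m n (U W : {set 'M[F]_(m, n)}) :
    2 \in [pchar F] -> (16 < #|F|)%N -> zmod_closed U -> zmod_closed W ->
    (forall u : 'M[F]_(m, n), (map_mx GRing.inv u \in W) = (u \in U)) ->
    (forall u v, u \in U ->
       map_mx GRing.inv (u + v) - map_mx GRing.inv v \in W) ->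
  forall (u : 'M[F]_(m, n)) i j c,
    u \in U -> u i j != 0 -> c *: delta_mx i j \in U.
Proof.
move=> F2 bigF clU clW UW dUW u i j c Uu u_ij.
pose brick (X : {set 'M[F]_(m, n)}) := [set d | d *: delta_mx i j \in X].
have cl_brick (X : {set 'M[F]_(m, n)}) : zmod_closed X -> zmod_closed (brick X).
  move=> [X0 XB]; split=> [|d e]; rewrite !inE ?scale0r // scalerBl.
  exact: XB.
have UWij d : (d^-1 \in brick W) = (d \in brick U).
  rewrite !inE -UW; congr (_ \in W).
  apply/matrixP=> k l; rewrite !mxE.
  by case: (_ && _); rewrite ?mulr1 ?mulr0 ?invr0.
suff /setP/(_ c) : brick U = [set: F] by rewrite !inE.
apply: (inv_closed_full F2 (cl_brick U clU) (cl_brick W clW) UWij).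
have leW : (#|F| <= #|brick W| * 4)%N.
  apply: leq_trans (card_inv_difference u_ij) _; rewrite leq_mul2r /=.
  set D := [set _ | x : F].
  rewrite -(card_imset D (addIr (- (u i j)^-1))).
  apply: subset_leq_card; apply/subsetP=> _ /imsetP[_ /imsetP[x _ ->] ->].
  have [_ WB] := clW.
  rewrite inE; have -> : ((x + u i j)^-1 - x^-1 - (u i j)^-1) *: delta_mx i j =
      map_mx GRing.inv (u + x *: delta_mx i j)
      - map_mx GRing.inv (x *: delta_mx i j) - map_mx GRing.inv u.
    apply/matrixP=> k l; rewrite !mxE.
    have [/andP[/eqP-> /eqP->] | _] := boolP (_ && _).
      by rewrite !mulr1 [x + _]addrC.
    by rewrite !mulr0 invr0 addr0 subr0 subrr.
  by apply: (WB); rewrite ?UW ?dUW.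
have WUcard : #|brick W| = #|brick U|.
  rewrite -(card_imset (brick U) invr_inj); apply: eq_card => d.
  by rewrite -{2}[d]invrK (mem_imset _ _ invr_inj) -UWij invrK.
rewrite -mulnn -(ltn_pmul2l (isT : 0 < 16)%N).
apply: leq_trans (_ : #|F| * #|F| <= _)%N.
  by rewrite ltn_pmul2r // (ltn_trans _ bigF).
apply: leq_trans (leq_mul leW leW) _.
by rewrite WUcard mulnACA mulnC.
Qed.

(** * The layers of AES *)

Lemma gamma_funE : gamma_fun =1 map_mx GRing.inv.
Proof.
move=> a; apply/matrixP=> i j; rewrite !mxE; move: (a i j) => x {a i j}.
have [-> | x0] := eqVneq x 0; first by rewrite invr0 expr0n.
do 2!apply: (mulfI x0); rewrite mulfV // mulr1 -!exprS.
by rewrite -[RHS]expf_card card_GF256.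
Qed.

Lemma gammaE x : gamma x = map_mx GRing.inv x.
Proof. by rewrite permE gamma_funE. Qed.

Lemma gammaK : involutive gamma.
Proof.
by move=> x; rewrite !gammaE; apply/matrixP=> i j; rewrite !mxE invrK.
Qed.

Lemma sbox_linearB : {morph sbox_linear : x y / x - y}.
Proof.
have bitB x y j : byte_bit (x - y) j = byte_bit x j - byte_bit y j.
  exact: coefB.
move=> x y; apply: byte_bit_inj => j.
by rewrite bitB !byte_bitK !bitB; ring.
Qed.

Lemma sbox_linear0 : sbox_linear 0 = 0.
Proof. by rewrite -[X in sbox_linear X](subrr 0) sbox_linearB subrr. Qed.

Lemma lambda_fun_entry x i j :
  lambda_fun x i j = \sum_k mix_matrix i k * sbox_linear (x k (j + k)).
Proof. by rewrite mxE; apply: eq_bigr => k _; rewrite !mxE. Qed.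

Lemma lambda_funB : {morph lambda_fun : x y / x - y}.
Proof.
move=> x y; apply/matrixP=> i j.
rewrite [RHS]mxE [X in _ = _ + X]mxE !lambda_fun_entry.
rewrite -sumrB; apply: eq_bigr => k _.
by rewrite [(x - y) _ _]mxE [(- y) _ _]mxE sbox_linearB mulrBr.
Qed.

Lemma lambda_fun0 : lambda_fun 0 = 0.
Proof. by rewrite -[X in lambda_fun X](subrr 0) lambda_funB subrr. Qed.

(** For this reason a single nonzero byte of a column affects all four bytes of
    its image under MixColumns. *)
Lemma mix_matrix_neq0 i j : mix_matrix i j != 0.
Proof.
have theta_bits : theta = byte_of_bits (fun j => (j == 1)%N%:R).
  rewrite /byte_of_bits !big_ord_recl big_ord0 /= !scale0r !add0r scale1r addr0.
  by rewrite expr1.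
have theta1_bits : theta + 1 = byte_of_bits (fun j => (j <= 1)%N%:R).
  rewrite theta_bits /byte_of_bits !big_ord_recl !big_ord0 /= !scale0r !scale1r.
  by rewrite !add0r !addr0 addrC.
have bit0 k : byte_bit 0 k = 0 by apply: coef0.
have theta0 : theta != 0.
  apply/eqP=> /(congr1 (fun x => byte_bit x 1)).
  by rewrite theta_bits byte_bitK bit0.
have theta10 : theta + 1 != 0.
  apply/eqP=> /(congr1 (fun x => byte_bit x 1)).
  by rewrite theta1_bits byte_bitK bit0.
rewrite mxE.
by case: i j => [[|[|[|[|//]]]] ?] [[|[|[|[|//]]]] ?] /=; rewrite ?oner_neq0.
Qed.

(** A nonzero byte in row i and column j is moved by ShiftRows to column j - i,
    and then spread over this whole column by MixColumns. *)
Lemma lambda_fun_delta_neq0 i j i' :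
  lambda_fun (delta_mx i j) i' (j - i) != 0.
Proof.
rewrite lambda_fun_entry (bigD1 i) //= big1 => [|k /negPf ne_ki]; last first.
  by rewrite [delta_mx _ _ _ _]mxE ne_ki sbox_linear0 mulr0.
rewrite addr0 mulf_neq0 ?mix_matrix_neq0 // subrK [delta_mx _ _ _ _]mxE !eqxx.
by rewrite -sbox_linear0 (inj_eq sbox_linear_inj) oner_neq0.
Qed.

Lemma rhoE x : rho x = lambda_fun (gamma x).
Proof. by rewrite permM [lambda _]permE. Qed.

Lemma rho0 : rho 0 = 0.
Proof.
rewrite rhoE gammaE (_ : map_mx _ 0 = 0) ?lambda_fun0 //.
by apply/matrixP=> i j; rewrite !mxE invr0.
Qed.

(** * Primitivity *)

(** With [W] the preimage of [U] under lambda, invariance of the cosets of [U]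
    says that gamma maps [U] onto [W] and has all its derivatives in directions
    of [U] inside [W], so [brick_subset] shows that [U] is a sum of bricks.  A
    sum of bricks is gamma-invariant, hence lambda-invariant, and two successive
    applications of lambda spread one brick over the whole state. *)
Lemma rho_block_full (U : {set state}) :
    zmod_closed U -> (forall x y, (rho x - rho y \in U) = (x - y \in U)) ->
    U != [set 0] ->
  U = [set: state].
Proof.
move=> clU rhoU U_neq0.
have [U0 UB] := clU.
pose W := [set x | lambda_fun x \in U].
have clW : zmod_closed W.
  by split=> [|x y]; rewrite !inE ?lambda_fun0 // lambda_funB; apply: UB.
have Urho x : (rho x \in U) = (x \in U).
  by have := rhoU x 0; rewrite rho0 !subr0.
have F2 : 2 \in [pchar GF256] := pchar_GF256.
have brick u i j c : u \in U -> u i j != 0 -> c *: delta_mx i j \in U.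
  apply: (brick_subset (W := W)) => // [|x|x v Ux]; first by rewrite card_GF256.
    by rewrite inE -gammaE -rhoE Urho.
  by rewrite inE -!gammaE lambda_funB -!rhoE rhoU addrK.
have gammaU x : x \in U -> gamma x \in U.
  move=> Ux; apply: (bricks_mem clU) => i j; rewrite gammaE mxE invr_eq0.
  exact: brick.
have lambdaU x : x \in U -> lambda_fun x \in U.
  by move=> /gammaU; rewrite -Urho rhoE gammaK.
have spread i j : delta_mx i j \in U -> forall i', delta_mx i' (j - i) \in U.
  move=> Uij i'; rewrite -[delta_mx _ _]scale1r.
  exact: brick (lambdaU _ Uij) (lambda_fun_delta_neq0 i j i').
have [u Uu u_neq0] : exists2 u, u \in U & u != 0.
  apply/exists_inP; apply: contraR U_neq0 => /exists_inPn H.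
  rewrite eqEsubset sub1set U0 andbT; apply/subsetP=> u /H.
  by rewrite negbK inE.
have /existsP[i /existsP[j u_ij]] : [exists i, exists j, u i j != 0].
  apply: contraR u_neq0 => /existsPn H; apply/eqP/matrixP=> i j.
  by rewrite mxE; apply/eqP; have /existsPn/(_ j)/negPn := H i.
have Uij : delta_mx i j \in U.
  by rewrite -[delta_mx _ _]scale1r; apply: brick u_ij.
(* A first step reaches every row i' of column j - i, a second one all of
   column (j - i) - i'; the choice i' = (j - i) - l makes this column l. *)
have all_delta k l : delta_mx k l \in U.
  rewrite -[l](subKr (j - i)); exact: spread (spread _ _ Uij _) _.
apply/setP=> x; rewrite inE; apply: (bricks_mem clU) => k l _.
by apply: brick (all_delta k l) _; rewrite mxE !eqxx oner_neq0.
Qed.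

Theorem corollary5p3 :
  [primitive <<[set (rho * sigma k)%g | k : state]>>%g, on [set: state] | 'P].
Proof.
set G := <<_>>%g.
have G_gen k : (rho * sigma k)%g \in G by apply: mem_gen; apply: imset_f.
have sigma0 : sigma 0 = 1%g by apply/permP=> x; rewrite !permE addr0.
have G_rho : rho \in G by have := G_gen 0; rewrite sigma0 mulg1.
have G_sigma k : sigma k \in G.
  by rewrite -(groupMl _ G_rho).
apply/andP; split.
  apply/imsetP; exists 0; rewrite ?inE //; apply/setP=> x; rewrite inE.
  by apply/esym/orbitP; exists (sigma x); rewrite //= /aperm permE add0r.
apply/existsPn=> Q; apply/negP=> /and4P[partQ actQ Q_gt1].
have cardQ := card_pblock_partition G_sigma partQ actQ.
rewrite cardsT cardQ.
have [U1 | U_neq0] := eqVneq (pblock Q 0) [set 0].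
  by rewrite U1 cards1 muln1 ltnn.
have UT := rho_block_full (pblock0_zmod_closed G_sigma partQ actQ)
  (fun x y => mem_pblock0_perm_sub G_sigma partQ actQ x y G_rho) U_neq0.
move: cardQ Q_gt1; rewrite UT cardsT => cardQ Q_gt1 _.
have V_gt0 : (0 < #|[the finType of state]|)%N by apply/card_gt0P; exists 0.
by have := ltn_Pmull Q_gt1 V_gt0; rewrite -cardQ ltnn.
Qed.
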